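(* Let $G$ be a Lie group, $\mathfrak g$ its Lie algebra, $T^*G$ its cotangent bundle and $\mathcal D:=\mathfrak g\ltimes\mathfrak g^*=\mathrm{Lie}(T^*G)$. Every derivation $\phi$ of $\mathcal D$ has the form $$\phi(x,f)=\big(\alpha(x)+\psi(f),\ \beta(x)+f\circ(j-\alpha)\big)\qquad\text{for all }(x,f)\in\mathcal D,$$ where - $\alpha:\mathfrak g\to\mathfrak g$ is a derivation of the Lie algebra $\mathfrak g$; - $j:\mathfrak g\to\mathfrak g$ belongs to $\mathcal J$; - $\beta:\mathfrak g\to\mathfrak g^*$ is a $1$-cocycle of $\mathfrak g$ with values in $\mathfrak g^*$ for the coadjoint action, i.e. $\beta([x,y])=ad^*_x\beta(y)-ad^*_y\beta(x)$ for all $x,y\in\mathfrak g$; - $\psi:\mathfrak g^*\to\mathfrak g$ is a linear map satisfying $\psi\circ ad^*_x=ad_x\circ\psi$ and $ad^*_{\psi(f)}g=ad^*_{\psi(g)}f$ for all $x\in\mathfrak g$ and $f,g\in\mathfrak g^*$. If moreover $G$ has a bi-invariant Riemannian or pseudo-Riemannian metric $\mu$, then every derivation $\phi$ of $\mathcal D$ can be written $$\phi(x,f)=\big(\alpha(x)+j\circ\theta^{-1}(f),\ \theta\circ\alpha'(x)+f\circ(j'-\alpha)\big)\qquad\text{for all }(x,f)\in\mathcal D,$$ where $\alpha,\alpha'$ are derivations of $\mathfrak g$, the maps $j,j'$ belong to $\mathcal J$, and $\theta:\mathfrak g\to\mathfrak g^*$ is given by $\theta(x)(y):=\mu(x,y)$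 for all $x,y\in\mathfrak g$.
   Context: Lie groups and Lie algebras are real and finite dimensional. For $x\in\mathfrak g$, $ad_x(y)=[x,y]$, and the coadjoint representation is $ad^*_xf=-f\circ ad_x$ for $f\in\mathfrak g^*$. The cotangent bundle $T^*G$, identified with $G\times\mathfrak g^*$ by left translations, carries the Lie group structure of the semi-direct product $G\ltimes\mathfrak g^*$ via the coadjoint action of $G$ on the abelian group $\mathfrak g^*$. Its Lie algebra $\mathcal D=\mathfrak g\ltimes\mathfrak g^*$ has bracket $[(x,f),(y,g)]=([x,y],\,ad^*_xg-ad^*_yf)$. $\mathcal J$ denotes the space of linear maps $j:\mathfrak g\to\mathfrak g$ with $j([x,y])=[j(x),y]$ for all $x,y\in\mathfrak g$. A bi-invariant metric $\mu$ on $G$ (invariant under left and right translations) also denotes its value on $\mathfrak g$, a non-degenerate symmetric bilinear form with $\mu([x,y],z)+\mu(y,[x,z])=0$. *)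

(* Defs.v *)
From HB Require Import structures.
From mathcomp Require Import all_boot all_order all_algebra.
From mathcomp Require Import reals ring.

Set Implicit Arguments.
Unset Strict Implicit.
Unset Printing Implicit Defensive.

Import GRing.Theory.
Local Open Scope ring_scope.

Reserved Notation "[ 'lie' x , y ]" (format "[ 'lie'  x ,  y ]").

(* Finite-dimensional Lie algebras over a field; the dimension is finite
   because the carrier is a vectType. *)
HB.mixin Record Vector_isLieAlgebra (R : fieldType) V of Vector R V := {
  lie_bracket : V -> V -> V;
  lie_linearl : forall y, linear (lie_bracket^~ y);
  lie_linearr : forall x, linear (lie_bracket x);
  lie_alt : forall x, lie_bracket x x = 0;
  lie_jacobi : forall x y z,
    lie_bracket x (lie_bracket y z) + lie_bracket y (lie_bracket z x)
      + lie_bracket z (lie_bracket x y) = 0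
}.

#[short(type="lieAlgType")]
HB.structure Definition LieAlgebra (R : fieldType) :=
  {V of Vector_isLieAlgebra R V & Vector R V}.

Notation "[ 'lie' x , y ]" := (lie_bracket x y) : ring_scope.

Notation dual g := 'Hom(g, _^o).

Section LieAlgebraTheory.
Variables (R : fieldType) (g : lieAlgType R).
Implicit Types (x y z : g) (f : dual g).

HB.instance Definition _ x :=
  GRing.isLinear.Build R g g _ (@lie_bracket R g x) (lie_linearr x).

Lemma lieDl x y z : [lie x + y, z] = [lie x, z] + [lie y, z].
Proof. by have := lie_linearl z 1 x y; rewrite !scale1r. Qed.

Lemma lieDr x y z : [lie x, y + z] = [lie x, y] + [lie x, z].
Proof. exact: raddfD. Qed.

Lemma lieZl a x y : [lie a *: x, y] = a *: [lie x, y].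
Proof.
have lie0l : [lie 0, y] = 0 by apply: (addrI [lie 0, y]); rewrite -lieDl !addr0.
by have := lie_linearl y a x 0; rewrite !addr0 lie0l addr0.
Qed.

Lemma lieC x y : [lie x, y] = - [lie y, x].
Proof.
apply/eqP; rewrite -addr_eq0; apply/eqP.
by have := lie_alt (x + y); rewrite lieDl !lieDr !lie_alt add0r addr0.
Qed.

Definition ad x : 'End(g) := linfun (@lie_bracket R g x).

Lemma adE x y : ad x y = [lie x, y].
Proof. exact: lfunE. Qed.

Definition coad x f : dual g := (- (f \o ad x))%VF.

Lemma coadE x f y : coad x f y = - f [lie x, y].
Proof. by rewrite opp_lfunE comp_lfunE adE. Qed.

Lemma coadDr x f1 f2 : coad x (f1 + f2) = coad x f1 + coad x f2.
Proof. by rewrite /coad comp_lfunDl opprD. Qed.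

Lemma coadZr x a f : coad x (a *: f) = a *: coad x f.
Proof. by rewrite /coad -comp_lfunZl scalerN. Qed.

Lemma coadNr x f : coad x (- f) = - coad x f.
Proof. by rewrite /coad comp_lfunNl. Qed.

Lemma coadDl x y f : coad (x + y) f = coad x f + coad y f.
Proof.
apply/lfunP => z; rewrite /coad !(add_lfunE, opp_lfunE, comp_lfunE) !adE.
by rewrite lieDl raddfD opprD.
Qed.

Lemma coadZl a x f : coad (a *: x) f = a *: coad x f.
Proof.
apply/lfunP => z; rewrite /coad !(scale_lfunE, opp_lfunE, comp_lfunE) !adE.
by rewrite lieZl linearZ scalerN.
Qed.

Lemma coad_lie x y f : coad [lie x, y] f = coad x (coad y f) - coad y (coad x f).
Proof.
have jac z : [lie [lie x, y], z] = [lie x, [lie y, z]] - [lie y, [lie x, z]].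
  have /eqP := lie_jacobi x y z.
  rewrite addr_eq0 -(lieC [lie x, y] z) => /eqP <-.
  by rewrite (lieC z x) raddfN.
apply/lfunP => z; rewrite /coad !(add_lfunE, opp_lfunE, comp_lfunE) !adE.
by rewrite !opprK jac raddfB opprB.
Qed.

End LieAlgebraTheory.

(* The underlying space of the Lie algebra g |x g^* of T^*G; an alias of the
   product, so that the semi-direct bracket is not attached to every pair
   type. *)
Definition cotangent_lie (R : fieldType) (g : lieAlgType R) : Type :=
  (g * dual g)%type.

HB.instance Definition _ (R : fieldType) (g : lieAlgType R) :=
  Vector.copy (cotangent_lie g) (g * dual g)%type.

Section CotangentLie.
Variables (R : fieldType) (g : lieAlgType R).
Implicit Types u v w : cotangent_lie g.

Definition cotangent_bracket u v : cotangent_lie g :=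
  ([lie u.1, v.1], coad u.1 v.2 - coad v.1 u.2).

Fact cotangent_linearl v : linear (cotangent_bracket^~ v).
Proof.
move=> a u w; congr pair => /=; first exact: lie_linearl.
rewrite coadDl coadZl coadDr coadZr scalerBr opprD addrACA.
by congr (_ + _).
Qed.

Fact cotangent_linearr u : linear (cotangent_bracket u).
Proof.
move=> a v w; congr pair => /=; first exact: lie_linearr.
by rewrite coadDl coadZl coadDr coadZr scalerBr opprD addrACA.
Qed.

Fact cotangent_alt u : cotangent_bracket u u = 0.
Proof. by congr pair; rewrite /= ?lie_alt ?subrr. Qed.

Fact cotangent_jacobi u v w :
  cotangent_bracket u (cotangent_bracket v w)
    + cotangent_bracket v (cotangent_bracket w u)
    + cotangent_bracket w (cotangent_bracket u v) = 0.
Proof.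
congr pair => /=; first exact: lie_jacobi.
rewrite !coad_lie.
rewrite !(coadDr, coadNr).
move: (coad u.1 _) (coad u.1 _) (coad v.1 _) (coad v.1 _) (coad w.1 _)
  (coad w.1 _).
move=> a b c d e h; apply/lfunP => z.
rewrite !(add_lfunE, opp_lfunE, zero_lfunE).
move: (a z : R) (b z : R) (c z : R) (d z : R) (e z : R) (h z : R).
by move=> a' b' c' d' e' h'; rewrite /GRing.regular; ring.
Qed.

HB.instance Definition _ := Vector_isLieAlgebra.Build R (cotangent_lie g)
  cotangent_linearl cotangent_linearr cotangent_alt cotangent_jacobi.

Lemma lie_cotangentE (x y : g) (f h : dual g) :
  [lie (x, f) : cotangent_lie g, (y, h)]
    = ([lie x, y], coad x h - coad y f).
Proof. by []. Qed.

End CotangentLie.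

Section Predicates.
Variables (R : fieldType) (g : lieAlgType R).

Definition is_derivation (d : 'End(g)) : Prop :=
  forall x y, d [lie x, y] = [lie d x, y] + [lie x, d y].

Definition in_J (j : 'End(g)) : Prop :=
  forall x y, j [lie x, y] = [lie j x, y].

Definition is_coad_cocycle (beta : 'Hom(g, dual g)) : Prop :=
  forall x y, beta [lie x, y] = coad x (beta y) - coad y (beta x).

Definition ad_invariant (mu : {symmetric g}) : Prop :=
  forall x y z, mu [lie x, y] z + mu y [lie x, z] = 0.

(* theta : g -> g^*, theta(x)(y) = mu(x, y); see thetaE. *)
Definition theta (mu : {symmetric g}) : 'Hom(g, dual g) :=
  linfun (fun x => linfun (mu x : g -> R^o) : dual g).

Lemma thetaE (mu : {symmetric g}) x y : theta mu x y = mu x y.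
Proof.
have muE u : linfun (mu u : g -> R^o) =1 mu u by exact: lfunE.
pose th u : dual g := linfun (mu u : g -> R^o).
have th_lin : linear th.
  move=> a u v; apply/lfunP => z.
  by rewrite add_lfunE scale_lfunE !muE linearDl linearZl_LR.
pose thL := GRing.isLinear.Build R g (dual g) _ th th_lin.
pose thF : {linear g -> dual g} := HB.pack th thL.
by rewrite /theta -[LHS]/(linfun thF x y) lfunE muE.
Qed.

Lemma lker_theta (mu : {symmetric g}) :
  nondegenerate mu -> lker (theta mu) = 0%VS.
Proof.
move=> /eqP ndg; apply/eqP; rewrite -subv0 -ndg; apply/subvP => x.
rewrite memv_ker => /eqP x0; apply/mem_orthovP => y _.
by rewrite -[LHS](thetaE mu x y) [theta mu x]x0 zero_lfunE.
Qed.

Lemma thetaK (mu : {symmetric g}) : nondegenerate mu ->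
  cancel (theta mu) (theta mu)^-1%VF /\ cancel (theta mu)^-1%VF (theta mu).
Proof.
move=> /lker_theta ker0; split; first by apply: lker0_lfunK; rewrite ker0.
move=> f; apply: limg_lfunVK.
suff -> : limg (theta mu) = fullv by exact: memvf.
apply/eqP; rewrite eqEdim subvf /= limg_dim_eq ?ker0 ?capv0 //.
by rewrite !dimvf /dim /= muln1.
Qed.

End Predicates.

(* Main.v *)
Require Import Defs.
From HB Require Import structures.
From mathcomp Require Import all_boot all_order all_algebra.
From mathcomp Require Import reals.
Import GRing.Theory.
Local Open Scope ring_scope.

(** Write a derivation [phi] of [g |x g^*] in blocks,
    [phi (x, f) = (alpha x + psi f, beta x + xi f)], and apply the Leibniz rule
    to the three kinds of pairs of homogeneous elements
    ([derivation_blocks]).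
    - On [(x, 0), (y, 0)] it says that [alpha] is a derivation and [beta] a
      cocycle.
    - On [(0, f), (0, h)], whose bracket vanishes because [g^*] is abelian, it
      is the symmetry [coad (psi f) h = coad (psi h) f].
    - On [(x, 0), (0, f)] it says that [psi] is equivariant and that
      [xi (coad x f) = coad (alpha x) f + coad x (xi f)].

    As [g] is finite dimensional, [xi] is the transpose [f |-> f \o A] of an
    endomorphism [A] of [g] ([transpose_surj]).  Testing the last identity
    against vectors of [g] shows that [A] fails to commute with the [ad x] just
    as [- alpha] does, so that [j = A + alpha] commutes with every [ad x] and
    lies in [J] ([in_J_transpose]).

    An invariant metric makes [theta] an isomorphism from the adjoint to the
    coadjoint representation ([theta_lie]).  Transporting along it turns the
    equivariant map [psi] into the element [psi \o theta] of [J], and the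
    cocycle [beta] into the derivation [theta^-1 \o beta]. *)

Section LinearAlgebra.
Set Implicit Arguments.
Unset Strict Implicit.
Variable K : fieldType.

Lemma linear_lfun (U V : vectType K) (f : U -> V) :
  linear f -> exists F : 'Hom(U, V), F =1 f.
Proof.
move=> f_lin.
pose fL := GRing.isLinear.Build K U V _ f f_lin.
pose fF : {linear U -> V} := HB.pack f fL.
by exists (linfun fF) => x; rewrite lfunE.
Qed.

Lemma lfun_blocks (U V : vectType K) (phi : 'End((U * V)%type)) :
  exists (a : 'End(U)) (b : 'Hom(U, V)) (c : 'Hom(V, U)) (d : 'End(V)),
    forall x f, phi (x, f) = (a x + c f, b x + d f).
Proof.
have inl_lin k (x y : U) :
    phi (k *: x + y, 0) = k *: phi (x, 0) + phi (y, 0).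
  by rewrite -linearP; congr (phi _); congr pair; rewrite /= ?scaler0 ?addr0.
have inr_lin k (f h : V) :
    phi (0, k *: f + h) = k *: phi (0, f) + phi (0, h).
  by rewrite -linearP; congr (phi _); congr pair; rewrite /= ?scaler0 ?addr0.
have [|a aE] := @linear_lfun U U (fun x => (phi (x, 0)).1).
  by move=> k x y; rewrite inl_lin.
have [|b bE] := @linear_lfun U V (fun x => (phi (x, 0)).2).
  by move=> k x y; rewrite inl_lin.
have [|c cE] := @linear_lfun V U (fun f => (phi (0, f)).1).
  by move=> k x y; rewrite inr_lin.
have [|d dE] := @linear_lfun V V (fun f => (phi (0, f)).2).
  by move=> k x y; rewrite inr_lin.
exists a, b, c, d => x f; rewrite aE bE cE dE.
have -> : (x, f) = (x, 0) + (0, f) :> U * V.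
  by congr pair; rewrite /= ?addr0 ?add0r.
exact: linearD.
Qed.

Lemma form_separates (V : vectType K) (u v : V) :
  (forall f : dual V, f u = f v) -> u = v.
Proof.
move=> uv; rewrite (coord_vbasis (memvf u)) (coord_vbasis (memvf v)).
apply: eq_bigr => i _; congr (_ *: _).
have [|F FE] := @linear_lfun V K^o (coord (vbasis {:V}) i).
  by move=> k x y; rewrite linearP.
by rewrite -!FE uv.
Qed.

(** The transpose of [xi] acts on the bidual of [V], which finite dimension
    identifies with [V]. *)
Lemma transpose_surj (V : vectType K) (xi : 'End(dual V)) :
  exists A : 'End(V), forall f, xi f = (f \o A)%VF.
Proof.
pose e := vbasis {:V}.
have /fin_all_exists [F FE] i : exists F : dual V, F =1 coord e i.
  by apply: linear_lfun => k x y; rewrite linearP.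
(* The matrix of [A] in the basis [e] is that of [xi] in the dual basis [F],
   transposed. *)
have [|A AE] := @linear_lfun V V (fun y => \sum_i (xi (F i) y : K) *: e`_i).
  move=> k x y; rewrite scaler_sumr -big_split; apply: eq_bigr => i _ /=.
  by rewrite linearP /= scalerDl scalerA.
exists A => f; apply/lfunP => y; rewrite comp_lfunE AE.
have {1}-> : f = \sum_(i < \dim {:V}) (f e`_i : K) *: F i.
  apply/lfunP => z; rewrite sum_lfunE {1}(coord_vbasis (memvf z)) linear_sum.
  apply: eq_bigr => i _; rewrite linearZ scale_lfunE FE /=.
  exact: mulrC.
rewrite !linear_sum sum_lfunE; apply: eq_bigr => i _.
rewrite !linearZ scale_lfunE /=; exact: mulrC.
Qed.

End LinearAlgebra.

Section CotangentDerivations.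
Set Implicit Arguments.
Unset Strict Implicit.
Variables (K : fieldType) (g : lieAlgType K).
Implicit Types (x y : g) (f h : dual g).

(** By antisymmetry of the bracket, [J] is the commutant of the adjoint
    representation: the form in which equivariance arguments produce it. *)
Lemma in_J_adjoint (j : 'End(g)) :
  (forall x y, j [lie x, y] = [lie x, j y]) -> in_J j.
Proof. by move=> jr x y; rewrite (lieC x y) linearN /= jr -lieC. Qed.

(** Evaluating the hypothesis on [A], which is the Leibniz rule for the pairs
    [(x, 0), (0, f)], at a vector [y] gives
    [A [x, y] = [x, A y] - [alpha x, y]], since forms separate points; adding
    [alpha [x, y] = [alpha x, y] + [x, alpha y]] cancels the terms in
    [alpha x]. *)
Lemma in_J_transpose (alpha A : 'End(g)) :
  is_derivation alpha ->
  (forall x f, (coad x f \o A)%VF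
     = coad (alpha x) f + coad x (f \o A)%VF) ->
  in_J (A + alpha).
Proof.
move=> der_alpha coadA; apply: in_J_adjoint => x y.
have Alie : A [lie x, y] = [lie x, A y] - [lie alpha x, y].
  apply: form_separates => f.
  have /lfunP/(_ y) := coadA x f.
  rewrite add_lfunE !comp_lfunE !coadE comp_lfunE => /eqP.
  rewrite linearB /= -opprD eqr_opp => /eqP ->.
  by rewrite addrAC subrr add0r.
by rewrite !add_lfunE Alie der_alpha lieDr addrA subrK.
Qed.

Lemma derivation_blocks (phi : 'End(cotangent_lie g)) (alpha : 'End(g))
    (beta : 'Hom(g, dual g)) (psi : 'Hom(dual g, g)) (xi : 'End(dual g)) :
  (forall x f, phi (x, f) = (alpha x + psi f, beta x + xi f)) ->
  is_derivation phi ->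
  [/\ is_derivation alpha, is_coad_cocycle beta,
      forall x f, psi (coad x f) = ad x (psi f),
      forall f h, coad (psi f) h = coad (psi h) f
    & forall x f, xi (coad x f) = coad (alpha x) f + coad x (xi f)].
Proof.
move=> phiE der_phi.
have coad0r x : coad x (0 : dual g) = 0 by rewrite /coad comp_lfun0l oppr0.
have coad0l f : coad (0 : g) f = 0 by rewrite -(scale0r (0 : g)) coadZl scale0r.
have phil x : phi (x, 0) = (alpha x, beta x).
  by rewrite phiE !linear0 !addr0.
have phir f : phi (0, f) = (psi f, xi f).
  by rewrite phiE !linear0 !add0r.
have phi_xy x y := der_phi (x, 0) (y, 0).
have phi_xf x f := der_phi (x, 0) (0, f).
have phi_fh f h := der_phi (0, f) (0, h).
split.
- move=> x y; have := phi_xy x y.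
  rewrite !phil !lie_cotangentE !coad0r subr0 phil.
  by case.
- move=> x y; have := phi_xy x y.
  rewrite !phil !lie_cotangentE !coad0r subr0 phil.
  by case=> _ ->; rewrite sub0r subr0 addrC.
- move=> x f; have := phi_xf x f.
  rewrite phil phir !lie_cotangentE !linear0 !coad0l !coad0r !subr0 phir.
  by case=> -> _; rewrite adE add0r.
- move=> f h; have := phi_fh f h.
  rewrite !phir !lie_cotangentE !linear0 !coad0l !subrr phir !linear0.
  by case=> _ /esym/eqP; rewrite addr0 sub0r subr_eq0 => /eqP.
- move=> x f; have := phi_xf x f.
  rewrite phil phir !lie_cotangentE !linear0 !coad0l !coad0r !subr0 phir.
  by case.
Qed.

Lemma derivation_form (phi : 'End(cotangent_lie g)) :
  is_derivation phi ->
  exists (alpha j : 'End(g)) (beta : 'Hom(g, dual g)) (psi : 'Hom(dual g, g)),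
    [/\ is_derivation alpha, in_J j, is_coad_cocycle beta,
        (forall x f, psi (coad x f) = ad x (psi f))
        /\ (forall f h, coad (psi f) h = coad (psi h) f)
      & forall x f,
          phi (x, f) = (alpha x + psi f, beta x + (f \o (j - alpha))%VF)].
Proof.
move=> der_phi.
have [alpha [beta [psi [xi phiE]]]] := @lfun_blocks K g (dual g) phi.
have [der_alpha coc_beta psi_equi psi_sym xi_coad] :=
  derivation_blocks phiE der_phi.
have [A xiE] := transpose_surj xi.
exists alpha, (A + alpha), beta, psi; split=> //.
  by apply: in_J_transpose => // x f; rewrite -!xiE xi_coad.
by move=> x f; rewrite phiE addrK xiE.
Qed.

Lemma theta_lie (mu : {symmetric g}) : ad_invariant mu ->
  forall x y, theta mu [lie x, y] = coad x (theta mu y).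
Proof.
move=> mu_inv x y; apply/lfunP => z; rewrite coadE !thetaE.
by apply/eqP; rewrite -addr_eq0 mu_inv.
Qed.

Lemma in_J_theta (mu : {symmetric g}) (psi : 'Hom(dual g, g)) :
  ad_invariant mu -> (forall x f, psi (coad x f) = ad x (psi f)) ->
  in_J (psi \o theta mu)%VF.
Proof.
move=> mu_inv psi_equi; apply: in_J_adjoint => x y.
by rewrite !comp_lfunE theta_lie // psi_equi adE.
Qed.

(** Pulled back by [theta], the term [- coad y (beta x)] of the cocycle
    identity becomes [- [y, theta^-1 (beta x)] = [theta^-1 (beta x), y]], so
    that the cocycle identity turns into the Leibniz rule. *)
Lemma derivation_theta (mu : {symmetric g}) (beta : 'Hom(g, dual g)) :
  nondegenerate mu -> ad_invariant mu -> is_coad_cocycle beta ->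
  is_derivation ((theta mu)^-1 \o beta)%VF.
Proof.
move=> /thetaK [thK thVK] mu_inv coc_beta x y.
apply: (can_inj thK); rewrite !comp_lfunE thVK coc_beta.
by rewrite (lieC _ y) linearD (linearN (theta mu)) /= !theta_lie // !thVK
  addrC.
Qed.

End CotangentDerivations.

Theorem theoremA (R : realType) (g : lieAlgType R) :
  (forall phi : 'End(cotangent_lie g), is_derivation phi ->
     exists (alpha j : 'End(g)) (beta : 'Hom(g, dual g)) (psi : 'Hom(dual g, g)),
       [/\ is_derivation alpha, in_J j, is_coad_cocycle beta,
           (forall (x : g) (f : dual g), psi (coad x f) = ad x (psi f))
           /\ (forall f h : dual g, coad (psi f) h = coad (psi h) f)
         & forall (x : g) (f : dual g),
             phi (x, f) = (alpha x + psi f, beta x + (f \o (j - alpha))%VF)])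
  /\
  (forall mu : {symmetric g}, nondegenerate mu -> ad_invariant mu ->
     forall phi : 'End(cotangent_lie g), is_derivation phi ->
     exists alpha alpha' j j' : 'End(g),
       [/\ is_derivation alpha, is_derivation alpha', in_J j, in_J j'
         & forall (x : g) (f : dual g),
             phi (x, f) = (alpha x + (j \o (theta mu)^-1)%VF f,
                           (theta mu \o alpha')%VF x + (f \o (j' - alpha))%VF)]).
Proof.
split=> [phi|mu mu_nd mu_inv phi der_phi]; first exact: derivation_form.
have [alpha [j [beta [psi [der_alpha Jj coc_beta [psi_equi _] phiE]]]]] :=
  derivation_form der_phi.
exists alpha, ((theta mu)^-1 \o beta)%VF, (psi \o theta mu)%VF, j; split=> //.
- exact: derivation_theta.
- exact: in_J_theta.
have [_ thVK] := thetaK mu_nd.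
by move=> x f; rewrite phiE !comp_lfunE !thVK.
Qed.
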